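(* Let $\mathbf{a}_1,\dots,\mathbf{a}_6\in\mathbb{C}^3$, $\mathbf{a}_j=(a_{j,1},a_{j,2},a_{j,3})$, and let $q_3=x_1^2+x_2^2+x_3^2$. Then $$q_3^2=\sum_{j=1}^6(a_{j,1}x_1+a_{j,2}x_2+a_{j,3}x_3)^4$$ (a tight decomposition of $q_3^2$) if and only if, up to complex orthogonal transformations and up to multiplying each point by a fourth root of unity, $\mathbf{a}_1,\dots,\mathbf{a}_6$ are the vertices, up to opposite signs, of a regular icosahedron inscribed in a sphere of radius $\left(\frac56\right)^{1/4}$; that is, if and only if there exist $A\in\mathrm{O}_3(\mathbb{C})$ and $\varepsilon_1,\dots,\varepsilon_6\in\mathbb{C}$ with $\varepsilon_j^4=1$ such that the points $\pm\varepsilon_jA\mathbf{a}_j$, $j=1,\dots,6$, are the twelve vertices of a regular icosahedron in $\mathbb{R}^3$ inscribed in the sphere of radius $\left(\frac56\right)^{1/4}$ centered at the origin.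
   Context: $\mathrm{O}_3(\mathbb{C})$ is the group of complex $3\times 3$ matrices $A$ with $A^{\mathsf T}A=I$. A decomposition of $q_3^2$ as a sum of fourth powers of complex linear forms is tight if it has $\binom{4}{2}=6$ summands. *)

(* Defs.v *)
From HB Require Import structures.
From mathcomp Require Import all_boot all_order all_algebra.
From mathcomp Require Import reals complex.
From mathcomp Require Import mpoly.

Set Implicit Arguments.
Unset Strict Implicit.
Unset Printing Implicit Defensive.

Import Order.TTheory GRing.Theory Num.Theory.
Local Open Scope ring_scope.

Definition quad_form (K : comNzRingType) (n : nat) : {mpoly K[n]} :=
  \sum_(k < n) 'X_k ^+ 2.

Definition lin_form (K : comNzRingType) (n : nat) (a : 'cV[K]_n) :
  {mpoly K[n]} := \sum_(k < n) a k ord0 *: 'X_k.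

(* No conjugation: over R[i] this is the complex orthogonal group O_n(C), not
   the unitary group. *)
Definition orthogonal_mx (K : comNzRingType) (n : nat) (A : 'M[K]_n) : Prop :=
  A^T *m A = 1%:M.

Definition eucl_norm (R : rcfType) (n : nat) (v : 'cV[R]_n) : R :=
  Num.sqrt (\sum_(k < n) v k ord0 ^+ 2).

Definition golden_ratio (R : rcfType) : R := (1 + Num.sqrt 5) / 2.

Definition vec3 (K : nzRingType) (x y z : K) : 'cV[K]_3 :=
  \col_(k < 3) [:: x; y; z]`_k.

(* The cyclic permutations of (0, s, t phi), where s and t are signs. *)
Definition std_icosahedron (R : rcfType) : seq 'cV[R]_3 :=
  let phi := golden_ratio R in
  [seq vec3 0 s (t * phi) | s <- [:: 1; -1], t <- [:: 1; -1]] ++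
  [seq vec3 (t * phi) 0 s | s <- [:: 1; -1], t <- [:: 1; -1]] ++
  [seq vec3 s (t * phi) 0 | s <- [:: 1; -1], t <- [:: 1; -1]].

(* V lists the vertices of a regular icosahedron, with arbitrary centre t, size
   c and orientation Q: regular icosahedra are the images of the standard one
   under the similarities of R^3. *)
Definition regular_icosahedron (R : rcfType) (V : seq 'cV[R]_3) : Prop :=
  exists (c : R) (Q : 'M[R]_3) (t : 'cV[R]_3),
    [/\ 0 < c, orthogonal_mx Q
      & V =i [seq c *: (Q *m v) + t | v <- std_icosahedron R]].

Definition inscribed_in_sphere (R : rcfType) (n : nat) (r : R)
    (V : seq 'cV[R]_n) : Prop :=
  forall v, v \in V -> eucl_norm v = r.

Definition complexify (R : rcfType) (n : nat) (v : 'cV[R]_n) : 'cV[R[i]%C]_n :=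
  map_mx (@real_complex R) v.

(* Main.v *)
Require Import Defs.
From HB Require Import structures.
From mathcomp Require Import all_boot all_order all_algebra.
From mathcomp Require Import perm.
From mathcomp Require Import reals complex.
From mathcomp Require Import mpoly.
From mathcomp Require Import ring lra.

Set Implicit Arguments.
Unset Strict Implicit.
Unset Printing Implicit Defensive.

Import Order.TTheory GRing.Theory Num.Theory.
Local Open Scope ring_scope.

(** Evaluating the polynomial identity turns a decomposition into the statement
    [(x.x)^2 = sum_j (a_j.x)^4] for all [x], where [.] is the bilinear (not
    Hermitian) dot product.  Polarizing gives the full symmetric 4-tensor
    [sum_j a_j (x) a_j (x) a_j (x) a_j] (lemma [quartic_rep_polarized]).

    Tightness enters through a dimension count.  The space of ternary quadratic
    forms has dimension 6, the number of summands, so the tensor identity says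
    that two explicit 6 x 6 matrices are inverse to each other.  Multiplying
    them in the other order gives (lemma [tight_gram])
      [(a_j.a_k)^2 = (a_j.a_j)(a_k.a_k)/5 + (2/3) delta_jk],
    whence [(a_j.a_j)^2 = 5/6].  After scaling each point by a fourth root of
    unity, all [a_j.a_j] equal [r = sqrt (5/6)], all [a_0.a_k] with [k != 0]
    equal [g = r / sqrt 5], and the other products are [g] or [- g]: the points
    span six equiangular lines.

    The signs are determined up to relabelling.  Contracting the tensor once
    gives the frame identity [tight_frame]; applied to the pair [a_0, a_k], it
    says that each [k != 0] has product [g] with exactly two of the four
    remaining points.  A 2-regular graph on five vertices is a pentagon
    (lemma [pentagon_relabel]), and the six axes of the icosahedron have exactly
    this pattern: one axis is positively linked to the other five, which form a
    pentagon.  So the Gram matrix is, up to a permutation, that of the scaled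
    axes, and two frames with the same Gram matrix differ by an orthogonal
    transformation (lemma [equal_gram_orthogonal]).

    Conversely, an icosahedron inscribed in a sphere centered at the origin is
    itself centered there.  Its twelve vertices are distinct, so each of the
    twelve points [+- eps_j A a_j] is a vertex exactly once.  The sum of the
    fourth powers over the vertices is therefore twice the sum over [j], and it
    is [2 (x.x)^2] by an algebraic identity that uses only [phi^2 = phi + 1].
    The identity is proved in any commutative ring over the reals, so it can be
    read directly in the polynomial ring with [x] the vector of variables. *)

(** * The bilinear dot product *)

Definition dot (K : comNzRingType) (n : nat) (x y : 'cV[K]_n) : K :=
  \sum_(k < n) x k ord0 * y k ord0.

Section Dot.
Variables (K : comNzRingType) (n : nat).
Implicit Types (x y z : 'cV[K]_n) (c : K) (A : 'M[K]_n).

Lemma dotE x y : dot x y = (x^T *m y) ord0 ord0.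
Proof. by rewrite mxE; apply: eq_bigr => k _; rewrite mxE. Qed.

Lemma dotC x y : dot x y = dot y x.
Proof. by apply: eq_bigr => k _; rewrite mulrC. Qed.

Lemma dotDr x y z : dot x (y + z) = dot x y + dot x z.
Proof. by rewrite !dotE mulmxDr mxE. Qed.

Lemma dotDl x y z : dot (x + y) z = dot x z + dot y z.
Proof. by rewrite dotC dotDr !(dotC z). Qed.

Lemma dotZr c x y : dot x (c *: y) = c * dot x y.
Proof. by rewrite !dotE -scalemxAr mxE. Qed.

Lemma dotZl c x y : dot (c *: x) y = c * dot x y.
Proof. by rewrite dotC dotZr dotC. Qed.

Lemma dot_delta x k : dot x (delta_mx k ord0) = x k ord0.
Proof.
rewrite /dot (bigD1 k) //= mxE !eqxx mulr1 big1 ?addr0 // => j jk.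
by rewrite mxE (negPf jk) mulr0.
Qed.

Lemma dot_mulmxl A x y : dot (A *m x) y = dot x (A^T *m y).
Proof. by rewrite !dotE trmx_mul mulmxA. Qed.

Lemma dot_orthogonal A x y : orthogonal_mx A -> dot (A *m x) (A *m y) = dot x y.
Proof. by move=> hA; rewrite dot_mulmxl mulmxA hA mul1mx. Qed.

End Dot.

Lemma orthogonal_mx_tr (K : comNzRingType) n (A : 'M[K]_n) :
  orthogonal_mx A -> orthogonal_mx A^T.
Proof. by move=> hA; rewrite /orthogonal_mx trmxK; apply: mulmx1C. Qed.

Lemma dot_map (K L : comNzRingType) (f : {rmorphism K -> L}) n
    (x y : 'cV[K]_n) :
  dot (map_mx f x) (map_mx f y) = f (dot x y).
Proof.
by rewrite /dot rmorph_sum; apply: eq_bigr => k _; rewrite !mxE rmorphM.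
Qed.

Lemma dot3 (K : comNzRingType) (x y : 'cV[K]_3) :
  dot x y = x 0 ord0 * y 0 ord0 + x 1 ord0 * y 1 ord0 + x 2 ord0 * y 2 ord0.
Proof.
rewrite /dot !big_ord_recl big_ord0 addr0 addrA.
by congr (_ + x _ _ * y _ _ + x _ _ * y _ _); apply: val_inj.
Qed.

(** * Tight representations: the Gram matrix *)

Definition quartic_rep (K : comNzRingType) (a : 'I_6 -> 'cV[K]_3) :=
  forall x, dot x x ^+ 2 = \sum_(j < 6) dot (a j) x ^+ 4.

Section Tight.
Variables (K : numFieldType) (a : 'I_6 -> 'cV[K]_3).
Hypothesis rep_a : quartic_rep a.

(** The product [xyzw] is [1/192] times the signed sum of the eight fourth powers
    [(x +- y +- z +- w)^4]: each of the [4!] orderings of the mixed term survives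
    in all eight.  Applying this to both sides of the representation gives the
    totally symmetric 4-tensor on the right. *)
Lemma quartic_rep_polarized x y z w :
  \sum_(j < 6) dot (a j) x * dot (a j) y * (dot (a j) z * dot (a j) w) =
  (dot x y * dot z w + dot x z * dot y w + dot x w * dot y z) / 3.
Proof.
pose P s t u := \sum_(j < 6) dot (a j) (x + s *: y + t *: z + u *: w) ^+ 4.
have nz : (192 : K) != 0 by rewrite pnatr_eq0.
apply: (mulfI nz).
transitivity (P 1 1 1 - P 1 1 (-1) - P 1 (-1) 1 + P 1 (-1) (-1)
  - P (-1) 1 1 + P (-1) 1 (-1) + P (-1) (-1) 1 - P (-1) (-1) (-1)).
  rewrite /P -!(sumrB, big_split) mulr_sumr; apply: eq_bigr => j _ /=.
  by rewrite !(dotDr, dotZr); ring.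
have sq s t u :
  dot (x + s *: y + t *: z + u *: w) (x + s *: y + t *: z + u *: w)
  = dot x x + s ^+ 2 * dot y y + t ^+ 2 * dot z z + u ^+ 2 * dot w w
    + 2 * (s * dot x y + t * dot x z + u * dot x w
           + s * t * dot y z + s * u * dot y w + t * u * dot z w).
  rewrite !(dotDl, dotDr, dotZl, dotZr).
  rewrite (dotC y x) (dotC z x) (dotC w x) (dotC z y) (dotC w y) (dotC w z).
  by ring.
by rewrite /P -!rep_a !sq; field.
Qed.

(** This is [quartic_rep_polarized] contracted over [x = y = e_i]; the factor
    [5/3] is [(3 + 2) / 3], with [3] the dimension. *)
Lemma tight_frame x y :
  \sum_(j < 6) dot (a j) (a j) * (dot (a j) x * dot (a j) y) = 5 / 3 * dot x y.
Proof.
transitivity (\sum_(i < 3) (\sum_(j < 6) dot (a j) (delta_mx i ord0)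
    * dot (a j) (delta_mx i ord0) * (dot (a j) x * dot (a j) y))).
  rewrite exchange_big; apply: eq_bigr => j _ /=; rewrite {1}/dot mulr_suml.
  by apply: eq_bigr => i _; rewrite dot_delta.
under eq_bigr do rewrite quartic_rep_polarized.
rewrite -mulr_suml 2!big_split /=.
under eq_bigr do rewrite dot_delta mxE !eqxx mul1r.
rewrite sumr_const card_ord.
under [X in _ + X + _]eq_bigr do rewrite dotC dot_delta dotC dot_delta.
under [X in _ + _ + X]eq_bigr do rewrite mulrC dotC dot_delta dotC dot_delta.
rewrite -mulr_natl -!/(dot x y).
by field.
Qed.

(** The six quadratic monomials in three variables, as pairs of indices. *)
Definition monomial2 (p : 'I_6) : 'I_3 * 'I_3 :=
  nth (0, 0) [:: (0, 0); (1, 1); (2, 2); (0, 1); (0, 2); (1, 2)]%R p.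

(** The quadratic forms [(a_j.x)^2] are as many as the quadratic monomials, so
    the matrix [U] of their coefficients is square.  The tensor identity gives a
    right inverse [W] of [U]; being square, [W] is also a left inverse, and the
    entries of [W *m U = 1] are the claimed relations.  [W] is [U] transposed,
    with the part along [x.x] corrected by [- (a_j.a_j) / 5] and each monomial
    weighted by [3/2] (squares) or [3] (mixed products, which occur twice in the
    dot product of symmetric matrices). *)
Lemma tight_gram j k :
  dot (a j) (a k) ^+ 2 - dot (a j) (a j) * dot (a k) (a k) / 5 =
  2 / 3 * (j == k)%:R.
Proof.
pose m p i := a i (monomial2 p).1 ord0 * a i (monomial2 p).2 ord0.
pose d p : K := ((monomial2 p).1 == (monomial2 p).2)%:R.
pose U := \matrix_(p, i) m p i.
pose W := \matrix_(i, p)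
  ((3 - 3 / 2 * d p) * (m p i - d p * dot (a i) (a i) / 5)).
have UW : U *m W = 1%:M.
  apply/matrixP => p q; rewrite !mxE.
  transitivity ((3 - 3 / 2 * d q) * (\sum_i m p i * m q i
      - d q / 5 * \sum_i dot (a i) (a i) * m p i)).
    rewrite mulr_sumr -sumrB mulr_sumr; apply: eq_bigr => i _.
    by rewrite !mxE; ring.
  rewrite /m; under eq_bigr do rewrite -!dot_delta.
  rewrite quartic_rep_polarized.
  under eq_bigr do rewrite -!dot_delta.
  rewrite tight_frame !dot_delta !mxE /d.
  by case: p q => [[|[|[|[|[|[|//]]]]]] hp] [[|[|[|[|[|[|//]]]]]] hq] /=; field.
have /matrixP/(_ j k) := mulmx1C UW.
rewrite !mxE !big_ord_recl big_ord0 !mxE /d /m /=.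
set b := (j == k)%:R.
by move=> <-; rewrite !dot3; field.
Qed.

End Tight.

Lemma quartic_rep_scale (K : comNzRingType) (a : 'I_6 -> 'cV[K]_3) eps :
  (forall j, eps j ^+ 4 = 1) -> quartic_rep a ->
  quartic_rep (fun j => eps j *: a j).
Proof.
move=> eps4 rep_a x; rewrite rep_a; apply: eq_bigr => j _.
by rewrite dotZl exprMn eps4 mul1r.
Qed.

Lemma tight_norm (K : numFieldType) (a : 'I_6 -> 'cV[K]_3) j :
  quartic_rep a -> dot (a j) (a j) ^+ 2 = 5 / 6.
Proof.
move=> rep_a; have := tight_gram rep_a j j; rewrite eqxx mulr1 => h.
transitivity (5 / 4 * (2 / 3) : K); last by field.
by rewrite -h; field.
Qed.

Lemma tight_inner (K : numFieldType) (a : 'I_6 -> 'cV[K]_3) j k :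
  quartic_rep a -> j != k ->
  dot (a j) (a k) ^+ 2 = dot (a j) (a j) * dot (a k) (a k) / 5.
Proof.
move=> rep_a jk; have /eqP := tight_gram rep_a j k.
by rewrite (negPf jk) mulr0 subr_eq0 => /eqP.
Qed.

(** * Two-regular graphs on five vertices *)

Definition pentagon_adj (j k : 'I_5) : bool :=
  (k == j.+1 %% 5 :> nat)%N || (j == k.+1 %% 5 :> nat)%N.

Lemma permutations_iota_nth n s : s \in permutations (iota 0 n) ->
  (forall j, j < n -> nth 0 s j < n)%N /\
  (forall j k, j < n -> k < n -> nth 0 s j = nth 0 s k -> j = k)%N.
Proof.
rewrite mem_permutations => s_perm.
have s_size : size s = n by rewrite (perm_size s_perm) size_iota.
split=> [j jn|j k jn kn /eqP].
  have : nth 0%N s j \in s by rewrite mem_nth ?s_size.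
  by rewrite (perm_mem s_perm) mem_iota.
by rewrite nth_uniq ?s_size // ?(perm_uniq s_perm) ?iota_uniq // => /eqP.
Qed.

(** A boolean test on natural numbers, so that a search through all graphs and
    all relabellings can be carried out by computation. *)
Definition relabels_pentagon (f : nat -> nat -> bool) (s : seq nat) : bool :=
  (all (fun j => all (fun k => (j == k) || (f (nth 0 s j) (nth 0 s k) ==
    ((k == j.+1 %% 5) || (j == k.+1 %% 5)))) (iota 0 5)) (iota 0 5))%N.

(** Every cycle has length at least 3, so a 2-regular graph on five vertices is a
    single 5-cycle.  The proof inspects all [2^10] graphs, each given by its ten
    possible edges. *)
Lemma relabels_pentagon_2regular (f : nat -> nat -> bool) :
  (forall j k, f j k = f k j) ->
  (forall j, j < 5 -> \sum_(0 <= k < 5) (k != j) * f j k = 2)%N ->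
  has (relabels_pentagon f) (permutations (iota 0 5)).
Proof.
pose table b01 b02 b03 b04 b12 b13 b14 b23 b24 b34 (j k : nat) :=
  nth false (nth [::] [:: [:: false; b01; b02; b03; b04];
    [:: b01; false; b12; b13; b14]; [:: b02; b12; false; b23; b24];
    [:: b03; b13; b23; false; b34]; [:: b04; b14; b24; b34; false]] j) k.
(* A conditional rather than an implication between booleans: call-by-value
   evaluation then skips the 120 relabellings of a graph that is not regular. *)
have brute (b01 b02 b03 b04 b12 b13 b14 b23 b24 b34 : bool) :
    if [&& b01 + b02 + b03 + b04 == 2, b01 + b12 + b13 + b14 == 2,
        b02 + b12 + b23 + b24 == 2, b03 + b13 + b23 + b34 == 2
      & b04 + b14 + b24 + b34 == 2]%N then
      has (relabels_pentagon (table b01 b02 b03 b04 b12 b13 b14 b23 b24 b34))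
        (permutations (iota 0 5))
    else true.
  by move: b01 b02 b03 b04 b12 b13 b14 b23 b24 b34; do 10!case; vm_compute.
move=> f_sym f_deg.
have sum5 j : (j < 5)%N -> (\sum_(0 <= k < 5) (k != j) * f j k =
    (0 != j) * f j 0 + ((1 != j) * f j 1 + ((2 != j) * f j 2 +
    ((3 != j) * f j 3 + (4 != j) * f j 4))))%N.
  by move=> j5; rewrite !big_nat_recl // big_geq // addn0.
have deg j (j5 : (j < 5)%N) := etrans (esym (sum5 j j5)) (f_deg j j5).
have [d0 d1 d2 d3 d4] : [/\ f 0 1 + f 0 2 + f 0 3 + f 0 4 = 2,
    f 0 1 + f 1 2 + f 1 3 + f 1 4 = 2, f 0 2 + f 1 2 + f 2 3 + f 2 4 = 2,
    f 0 3 + f 1 3 + f 2 3 + f 3 4 = 2 & f 0 4 + f 1 4 + f 2 4 + f 3 4 = 2]%N.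
  have := (deg 0 isT, deg 1 isT, deg 2 isT, deg 3 isT, deg 4 isT)%N.
  rewrite /= !mul0n !mul1n !add0n !addn0 !addnA.
  rewrite (f_sym 1 0)%N (f_sym 2 0)%N (f_sym 3 0)%N (f_sym 4 0)%N (f_sym 2 1)%N.
  rewrite (f_sym 3 1)%N (f_sym 4 1)%N (f_sym 3 2)%N (f_sym 4 2)%N (f_sym 4 3)%N.
  by case=> [[[[]]]].
have := brute (f 0 1) (f 0 2) (f 0 3) (f 0 4) (f 1 2) (f 1 3) (f 1 4)
  (f 2 3) (f 2 4) (f 3 4).
rewrite d0 d1 d2 d3 d4 !eqxx.
move=> /hasP[s s_perm s_iso]; apply/hasP; exists s => //.
have [s_lt s_inj] := permutations_iota_nth s_perm.
apply/allP => j j5; apply/allP => k k5.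
have /allP/(_ _ j5)/allP/(_ _ k5) := s_iso.
case: eqP => //= jk /eqP <-; apply/eqP.
move: j5 k5; rewrite !mem_iota !add0n /= => j5 k5.
have : nth 0%N s j <> nth 0%N s k by move=> /(s_inj j k j5 k5).
move: (nth 0%N s j) (nth 0%N s k) (s_lt j j5) (s_lt k k5).
by move=> [|[|[|[|[|//]]]]] [|[|[|[|[|//]]]]].
Qed.

Lemma pentagon_relabel (e : rel 'I_5) : ssrbool.symmetric e ->
  (forall j, (\sum_(k < 5 | k != j) e j k)%N = 2%N) ->
  exists p : {perm 'I_5}, forall j k, j != k ->
    e (p j) (p k) = pentagon_adj j k.
Proof.
move=> e_sym e_deg.
have /hasP[s s_perm /allP s_iso] :
    has (relabels_pentagon (fun j k => e (inord j) (inord k)))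
        (permutations (iota 0 5)).
  apply: relabels_pentagon_2regular => [j k|j j5]; first exact: e_sym.
  rewrite big_mkord; apply: etrans (e_deg (inord j)).
  rewrite [RHS]big_mkcond; apply: eq_bigr => k _.
  by rewrite inord_val -val_eqE /= inordK //; case: eqP; rewrite ?mul1n.
have pi : injective (fun j : 'I_5 => inord (nth 0%N s j) : 'I_5).
  have [s_lt s_inj] := permutations_iota_nth s_perm.
  move=> j k /(congr1 val); rewrite /= !inordK ?s_lt //.
  by move=> /s_inj jk; apply/val_inj/jk.
exists (perm pi) => j k jk; rewrite !permE.
have mem_iota5 (i : 'I_5) : val i \in iota 0 5 by rewrite mem_iota /=.
have := s_iso _ (mem_iota5 j).
move=> /allP/(_ _ (mem_iota5 k))/orP[/eqP/val_inj/eqP|/eqP //].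
by rewrite (negPf jk).
Qed.

(** * The six axes of the icosahedron *)

Section Icosahedron.
Variable R : rcfType.
Local Notation phi := (golden_ratio R).

Lemma golden_ratio_sqr : phi ^+ 2 = phi + 1.
Proof.
have h : Num.sqrt 5 ^+ 2 = 5 :> R by rewrite sqr_sqrtr.
by rewrite /golden_ratio; field: h.
Qed.

Lemma golden_ratio_gt0 : 0 < phi.
Proof. by rewrite divr_gt0 // ltr_pwDl // sqrtr_ge0. Qed.

(** One vertex from each antipodal pair, chosen and ordered so that the first has
    product [phi] with the five others, and these form a pentagon in the cyclic
    order. *)
Definition axis (j : 'I_6) : 'cV[R]_3 :=
  nth 0 [:: vec3 0 1 phi; vec3 0 (-1) phi; vec3 phi 0 1;
            vec3 1 phi 0; vec3 (-1) phi 0; vec3 (- phi) 0 1] j.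

Lemma dot_vec3 (K : comNzRingType) (x y z x' y' z' : K) :
  dot (vec3 x y z) (vec3 x' y' z') = x * x' + y * y' + z * z'.
Proof. by rewrite dot3 !mxE. Qed.

Lemma scale_vec3 (K : comNzRingType) (c x y z : K) :
  c *: vec3 x y z = vec3 (c * x) (c * y) (c * z).
Proof. by apply/colP => -[[|[|[|//]]] i]; rewrite !mxE. Qed.

Lemma vec3_inj (K : comNzRingType) (x y z x' y' z' : K) :
  (vec3 x y z == vec3 x' y' z') = [&& x == x', y == y' & z == z'].
Proof.
apply/eqP/and3P => [/colP e|[/eqP-> /eqP-> /eqP->] //].
by have := (e 0, e 1, e 2); rewrite !mxE /= => -[[-> ->] ->].
Qed.

Lemma axis_norm j : dot (axis j) (axis j) = phi + 2.
Proof.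
case: j => [[|[|[|[|[|[|//]]]]]] ?]; rewrite /axis /= dot_vec3;
  by [ring: golden_ratio_sqr].
Qed.

Lemma axis_apex j : dot (axis ord0) (axis (lift ord0 j)) = phi.
Proof.
case: j => [[|[|[|[|[|//]]]]] ?]; rewrite /axis /= dot_vec3;
  by [ring: golden_ratio_sqr].
Qed.

Lemma axis_pentagon j k : j != k ->
  dot (axis (lift ord0 j)) (axis (lift ord0 k)) =
  if pentagon_adj j k then phi else - phi.
Proof.
case: j k => [[|[|[|[|[|//]]]]] ?] [[|[|[|[|[|//]]]]] ?] // _;
  by rewrite /axis /= dot_vec3; ring: golden_ratio_sqr.
Qed.

Lemma std_icosahedron_axis :
  std_icosahedron R =i [seq s *: axis j | s <- [:: 1; -1], j <- enum 'I_6].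
Proof.
move=> w; rewrite !enum_ordSl enum_ord0 /std_icosahedron /axis /= !scale_vec3.
rewrite !(mul1r, mulr1, mulN1r, opprK, mulr0, oppr0) !inE.
by apply/idP/idP; do ?[case/orP]; move=> /eqP->; rewrite !eqxx ?orbT.
Qed.

Lemma std_icosahedron_norm (v : 'cV[R]_3) :
  v \in std_icosahedron R -> dot v v = phi + 2.
Proof.
rewrite std_icosahedron_axis => /allpairsP[[s j] /= [s_in _ ->]].
rewrite dotZl dotZr axis_norm mulrA.
by move: s_in; rewrite !inE => /orP[] /eqP->; rewrite ?mulrNN !mul1r.
Qed.

Lemma std_icosahedron_uniq : uniq (std_icosahedron R).
Proof.
have phi_gt0 := golden_ratio_gt0.
have p0 : (phi == 0) = false by lra.
have p0' : (0 == phi) = false by lra.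
have q0 : (- phi == 0) = false by lra.
have q0' : (0 == - phi) = false by lra.
have pq : (phi == - phi) = false by lra.
have qp : (- phi == phi) = false by lra.
have ab : (1 == -1 :> R) = false by lra.
have ba : (-1 == 1 :> R) = false by lra.
have b0 : (-1 == 0 :> R) = false by lra.
have b0' : (0 == -1 :> R) = false by lra.
have a0 : (0 == 1 :> R) = false by lra.
have a0' : (1 == 0 :> R) = false by lra.
rewrite /std_icosahedron /= !(mul1r, mulN1r) !inE !vec3_inj.
rewrite !(p0, p0', q0, q0', pq, qp, ab, ba, b0, b0', a0, a0').
by rewrite ?(andbF, andFb).
Qed.

Lemma axis_tight (x : 'cV[R]_3) y :
  \sum_j dot (axis j) x * dot (axis j) y = 2 * (phi + 2) * dot x y.
Proof.
rewrite !big_ord_recl big_ord0 !dot3 /axis !mxE /=.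
by ring: golden_ratio_sqr.
Qed.

End Icosahedron.

Lemma scale_axis_std (R : rcfType) (s : R) j :
  s \in [:: 1; -1] -> s *: axis R j \in std_icosahedron R.
Proof.
move=> s_in; rewrite std_icosahedron_axis.
by apply/allpairsP; exists (s, j); rewrite mem_enum.
Qed.

Lemma axis_std (R : rcfType) j : axis R j \in std_icosahedron R.
Proof. by rewrite -[axis R j]scale1r scale_axis_std ?inE ?eqxx. Qed.

Lemma std_icosahedron_opp (R : rcfType) (v : 'cV[R]_3) :
  v \in std_icosahedron R -> - v \in std_icosahedron R.
Proof.
rewrite std_icosahedron_axis => /allpairsP[[s j] /= [s_in _ ->]].
rewrite -scaleNr; apply: scale_axis_std.
by move: s_in; rewrite !inE => /orP[] /eqP->; rewrite ?opprK eqxx ?orbT.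
Qed.



(** Stated through a ring morphism so that [x] may have real, complex or
    polynomial entries; only [phi^2 = phi + 1] is used about [phi]. *)
Lemma std_icosahedron_quartic (R : rcfType) (P : comNzRingType)
    (f : {rmorphism R -> P}) (x : 'cV[P]_3) :
  \sum_(v <- std_icosahedron R) dot (map_mx f v) x ^+ 4 =
  f (12 * golden_ratio R ^+ 2) * dot x x ^+ 2.
Proof.
have map_vec3 a b c : map_mx f (vec3 a b c) = vec3 (f a) (f b) (f c).
  by apply/colP => -[[|[|[|//]]] i]; rewrite !mxE.
rewrite /std_icosahedron /= !big_cons big_nil !map_vec3 !dot3 !mxE /=.
have h : f (golden_ratio R) ^+ 2 = f (golden_ratio R) + 1.
  by rewrite -rmorphXn golden_ratio_sqr rmorphD rmorph1.
move: (golden_ratio R) h => t h.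
rewrite !(rmorphXn, rmorphM, rmorphN, rmorph0, rmorph1, rmorph_nat).
by ring: h.
Qed.

(** * Reconstruction of the icosahedron from the Gram matrix *)

(** The map [C B^T / l] sends the frame [B] to [C]: since [B^T B = C^T C], it maps
    [B] to [C C^T C / l = C], and the same exchange shows that it is orthogonal. *)
Lemma equal_gram_orthogonal (K : fieldType) m n (B C : 'M[K]_(m, n)) (l : K) :
  l != 0 -> B *m B^T = l%:M -> C *m C^T = l%:M -> B^T *m B = C^T *m C ->
  exists2 A : 'M[K]_m, orthogonal_mx A & A *m B = C.
Proof.
move=> l0 BB CC BC; exists (l^-1 *: (C *m B^T)).
  rewrite /orthogonal_mx -scalemxAr linearZ /= -scalemxAl trmx_mul trmxK.
  rewrite mulmxA -(mulmxA B) -BC !mulmxA BB -mulmxA BB -scalar_mxM.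
  by rewrite !scale_scalar_mx mulKf // mulVf.
rewrite -scalemxAl -mulmxA BC mulmxA CC mul_scalar_mx scalerA mulVf //.
by rewrite scale1r.
Qed.

(** Since [(a_j.a_j)^2 = r^2], each [a_j.a_j] is [r] or [- r]; in the second case
    multiplying [a_j] by ['i] changes the sign.  The signs [+-1] that remain free
    are used to make the products with [a_0] equal to [g]. *)
Lemma tight_normalize (K : numClosedFieldType) (a : 'I_6 -> 'cV[K]_3)
    (r g : K) :
  quartic_rep a -> r ^+ 2 = 5 / 6 -> g ^+ 2 = 1 / 6 ->
  exists eps : 'I_6 -> K, let b j := eps j *: a j in
    [/\ forall j, eps j ^+ 4 = 1, forall j, dot (b j) (b j) = r
      & forall j, dot (b ord0) (b (lift ord0 j)) = g].
Proof.
move=> rep_a r2 g2.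
pose e j : K := if dot (a j) (a j) == r then 1 else 'i.
have e4 j : e j ^+ 4 = 1.
  by rewrite /e; case: ifP; rewrite ?expr1n // (exprM _ 2 2) sqrCi sqrrN expr1n.
pose b j := e j *: a j.
have b_norm j : dot (b j) (b j) = r.
  rewrite dotZl dotZr mulrA -expr2 /e.
  have /eqP := tight_norm j rep_a; rewrite -r2 eqf_sqr.
  case: eqP => [-> _|_ /= /eqP->]; first by rewrite expr1n mul1r.
  by rewrite sqrCi mulN1r opprK.
have rep_b := quartic_rep_scale e4 rep_a.
pose s j : K := if (j == ord0) || (dot (b ord0) (b j) == g) then 1 else -1.
have s2 j : s j * s j = 1 by rewrite /s; case: ifP; rewrite ?mulrNN mulr1.
exists (fun j => s j * e j); split=> j.
- by rewrite exprMn e4 mulr1 (exprM _ 2 2) [s j ^+ 2]expr2 s2 expr1n.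
- by rewrite -!scalerA dotZl dotZr mulrA s2 mul1r b_norm.
rewrite -!scalerA dotZl dotZr -!/(b _) {1}/s eqxx mul1r /s.
have /eqP : dot (b ord0) (b (lift ord0 j)) ^+ 2 = g ^+ 2.
  by rewrite (tight_inner rep_b) // !b_norm -expr2 r2 g2; field.
rewrite eqf_sqr; case: eqP => [-> _|_ /= /eqP->]; first by rewrite mul1r.
by rewrite mulN1r opprK.
Qed.

Section Normalized.
Variables (K : numFieldType) (b : 'I_6 -> 'cV[K]_3) (r g : K).
Hypothesis rep_b : quartic_rep b.
Hypothesis r2 : r ^+ 2 = 5 / 6.
Hypothesis g2 : g ^+ 2 = 1 / 6.
Hypothesis b_norm : forall j, dot (b j) (b j) = r.
Hypothesis b_apex : forall j, dot (b ord0) (b (lift ord0 j)) = g.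

Let link (j k : 'I_5) := dot (b (lift ord0 j)) (b (lift ord0 k)) == g.

Lemma link_inner j k : j != k ->
  dot (b (lift ord0 j)) (b (lift ord0 k)) = if link j k then g else - g.
Proof.
move=> jk; have /eqP : dot (b (lift ord0 j)) (b (lift ord0 k)) ^+ 2 = g ^+ 2.
  rewrite (tight_inner rep_b) ?(inj_eq lift_inj) //.
  by rewrite !b_norm -expr2 r2 g2; field.
by rewrite eqf_sqr /link; case: eqP => [-> //|_ /eqP].
Qed.

(** The frame identity for the pair [b_0, b_j] reads
      [2 r^2 g + r g S = (5/3) g = 2 r^2 g],
    where [S] is the sum of the products of [b_j] with the four points other than
    [b_0] and [b_j].  So [S = 0], and half of these four products are [g]. *)
Lemma link_2regular j : (\sum_(k < 5 | k != j) link j k)%N = 2%N.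
Proof.
have r0 : r != 0 by rewrite -sqrf_eq0 r2 mulf_eq0 invr_eq0 !pnatr_eq0.
have g0 : g != 0 by rewrite -sqrf_eq0 g2 div1r invr_eq0 pnatr_eq0.
have := tight_frame rep_b (b ord0) (b (lift ord0 j)).
rewrite b_apex big_ord_recl !b_norm b_apex (bigD1 j) //= !b_norm.
rewrite dotC b_apex => h.
have {}h : \sum_(k < 5 | k != j) ((link j k)%:R *+ 2 - 1 : K) = 0.
  apply: (mulfI (mulf_neq0 r0 (mulf_neq0 g0 g0))); rewrite mulr0 mulr_sumr.
  transitivity (\sum_(k < 5 | k != j) dot (b (lift ord0 k)) (b (lift ord0 k)) *
    (dot (b (lift ord0 k)) (b ord0) * dot (b (lift ord0 k)) (b (lift ord0 j)))).
    apply: eq_bigr => k kj; rewrite b_norm (dotC _ (b ord0)) b_apex dotC.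
    by rewrite link_inner 1?eq_sym //; case: (link j k) => /=; ring.
  move: h; set S := \sum_(i < 5 | _) _ => h.
  transitivity (5 / 3 * g - 2 * r ^+ 2 * g); first by rewrite -h; ring.
  by rewrite r2; field.
apply/eqP; rewrite -(eqr_nat K) natr_sum; apply/eqP.
move: h; rewrite sumrB sumr_const sumrMnl.
have -> : #|[pred k : 'I_5 | k != j]| = 4%N by rewrite cardC1 card_ord.
move=> /eqP; rewrite subr_eq0 => /eqP h.
by apply: (mulIf (_ : 2 != 0)); rewrite ?pnatr_eq0 // mulr_natr h; ring.
Qed.

Lemma normalized_gram (R : rcfType) (f : {rmorphism R -> K}) (t : R) :
  r = f (t * (golden_ratio R + 2)) -> g = f (t * golden_ratio R) ->
  exists p : 'S_6, forall j k,
    dot (b (p j)) (b (p k)) = f (t * dot (axis R j) (axis R k)).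
Proof.
move=> rE gE.
have link_sym : ssrbool.symmetric link by move=> j k; rewrite /link dotC.
have [p p_link] := pentagon_relabel link_sym link_2regular.
exists (lift_perm ord0 ord0 p) => j k.
have [->|] := eqVneq j k; first by rewrite b_norm axis_norm.
have [j1 ->|->] := unliftP ord0 j; have [k1 ->|->] := unliftP ord0 k.
- rewrite (inj_eq lift_inj) => jk; rewrite !lift_perm_lift axis_pentagon //.
  rewrite link_inner ?(inj_eq perm_inj) // p_link // gE.
  by case: ifP; rewrite ?mulrN ?rmorphN.
- by rewrite lift_perm_lift lift_perm_id dotC b_apex gE dotC axis_apex.
- by rewrite lift_perm_lift lift_perm_id b_apex gE axis_apex.
- by rewrite eqxx.
Qed.
End Normalized.

(** Both point sets are tight frames with constant [2 r], where [r] is the common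
    value [c^2 (phi + 2)] of the [b_j.b_j]: for the [b_j] the constant is
    [(5/3) / r], and [r^2 = 5/6]; for the scaled axes it is [2 c^2 (phi + 2)]. *)
Lemma gram_orthogonal (K : numFieldType) (R : rcfType)
    (f : {rmorphism R -> K}) (b : 'I_6 -> 'cV[K]_3) (c : R) (p : 'S_6) :
  quartic_rep b ->
  (c ^+ 2 * (golden_ratio R + 2)) ^+ 2 = 5 / 6 ->
  (forall j k,
    dot (b (p j)) (b (p k)) = f (c ^+ 2 * dot (axis R j) (axis R k))) ->
  exists2 A : 'M[K]_3, orthogonal_mx A &
    forall j, A *m b (p j) = map_mx f (c *: axis R j).
Proof.
move=> rep_b c4 gram.
set r := c ^+ 2 * (golden_ratio R + 2) in c4.
have r0 : f r != 0.
  by rewrite fmorph_eq0 -sqrf_eq0 c4 mulf_eq0 invr_eq0 !pnatr_eq0.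
pose B := \matrix_(i, j) b (p j) i ord0.
pose C := \matrix_(i, j) map_mx f (c *: axis R j) i ord0.
have colB j : col j B = b (p j) by apply/colP => i; rewrite !mxE.
have colC j : col j C = map_mx f (c *: axis R j).
  by apply/colP => i; rewrite !mxE.
have b_norm j : dot (b (p j)) (b (p j)) = f r by rewrite gram axis_norm.
have [||||A A_orth AB] := @equal_gram_orthogonal _ _ _ B C (2 * f r).
- by rewrite mulf_neq0 ?pnatr_eq0.
- apply/matrixP => i k; apply: (mulfI r0).
  transitivity (\sum_j dot (b j) (b j) * (dot (b j) (delta_mx i ord0) *
       dot (b j) (delta_mx k ord0))).
    rewrite [RHS](reindex_inj (@perm_inj _ p)) !mxE mulr_sumr /=.
    by apply: eq_bigr => j _; rewrite b_norm !mxE !dot_delta.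
  rewrite (tight_frame rep_b) dot_delta !mxE eq_sym eqxx andbT.
  rewrite -(mulr_natr (2 * f r)).
  have fr2 : f r ^+ 2 = 5 / 6 by rewrite -rmorphXn c4 fmorph_div !rmorph_nat.
  transitivity (2 * f r ^+ 2 * (i == k)%:R); last by ring.
  by rewrite fr2; field.
- apply/matrixP => i k; rewrite !mxE.
  transitivity (f (c ^+ 2 * \sum_j dot (axis R j) (delta_mx i ord0) *
      dot (axis R j) (delta_mx k ord0))).
    rewrite mulr_sumr rmorph_sum; apply: eq_bigr => j _.
    by rewrite !mxE !dot_delta -rmorphM; congr (f _); ring.
  rewrite axis_tight dot_delta !mxE eq_sym eqxx andbT -(mulr_natr (2 * f r)).
  by rewrite -!(rmorph_nat f) -!rmorphM; congr (f _); rewrite /r; ring.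
- apply/matrixP => j k.
  have gramE (X : 'M[K]_(3, 6)) : (X^T *m X) j k = dot (col j X) (col k X).
    by rewrite mxE; apply: eq_bigr => i _; rewrite !mxE.
  by rewrite !gramE !colB !colC gram dot_map dotZl dotZr mulrA.
exists A => // j.
by rewrite -colB -colC -AB colE mulmxA -colE.
Qed.

Lemma quartic_rep_icosahedron (R : rcfType) (a : 'I_6 -> 'cV[R[i]%C]_3) :
  quartic_rep a ->
  exists (A : 'M[R[i]%C]_3) (eps : 'I_6 -> R[i]%C) (c : R) (p : 'S_6),
    [/\ orthogonal_mx A, forall j, eps j ^+ 4 = 1,
       0 < c /\ c ^+ 2 * (golden_ratio R + 2) = Num.sqrt (5 / 6)
     & forall j, eps (p j) *: (A *m a (p j)) = complexify (c *: axis R j)].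
Proof.
move=> rep_a.
have phi_gt0 := golden_ratio_gt0 R; have phi2 := golden_ratio_sqr R.
set phi := golden_ratio R in phi_gt0 phi2 *.
set h := Num.sqrt (5 / 6) : R.
have h_gt0 : 0 < h by rewrite sqrtr_gt0; lra.
have h2 : h ^+ 2 = 5 / 6 by rewrite sqr_sqrtr //; lra.
have d_gt0 : 0 < phi + 2 by lra.
pose c := Num.sqrt (h / (phi + 2)).
have c_gt0 : 0 < c by rewrite sqrtr_gt0 divr_gt0.
have c2 : c ^+ 2 * (phi + 2) = h.
  by rewrite sqr_sqrtr ?divfK ?gt_eqF // ltW // divr_gt0.
have g2 : (c ^+ 2 * phi) ^+ 2 = 1 / 6.
  apply: (mulfI (_ : 5 != 0)); first by rewrite pnatr_eq0.
  (* [(phi + 2)^2 = 5 phi^2] *)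
  transitivity ((c ^+ 2 * (phi + 2)) ^+ 2); first by ring: phi2.
  by rewrite c2 h2; field.
pose f := @real_complex R.
have [|| eps [eps4 b_norm b_apex]] :=
  @tight_normalize _ a (f h) (f (c ^+ 2 * phi)) rep_a.
- by rewrite -rmorphXn h2 fmorph_div !rmorph_nat.
- by rewrite -rmorphXn g2 fmorph_div !rmorph_nat.
have rep_b := quartic_rep_scale eps4 rep_a.
have [||||p gram] :=
  normalized_gram rep_b _ _ b_norm b_apex (f := f) (t := c ^+ 2).
- by rewrite -rmorphXn h2 fmorph_div !rmorph_nat.
- by rewrite -rmorphXn g2 fmorph_div !rmorph_nat.
- by rewrite c2.
- by [].
have [|A A_orth AE] := gram_orthogonal rep_b _ gram; first by rewrite c2.
exists A, eps, c, p; split => // j.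
by have := AE j; rewrite -scalemxAr => ->.
Qed.

(** * Icosahedra inscribed in a sphere centered at the origin *)

Lemma eucl_norm_sqr (R : rcfType) n (v : 'cV[R]_n) :
  eucl_norm v ^+ 2 = dot v v.
Proof.
rewrite /eucl_norm sqr_sqrtr; last by apply: sumr_ge0 => k _; apply: sqr_ge0.
by apply: eq_bigr => k _; rewrite expr2.
Qed.

(** The axes form a tight frame, so [u.u] is a multiple of the sum of the squares
    [(axis_j.u)^2]. *)
Lemma orthogonal_to_std_icosahedron (R : rcfType) (u : 'cV[R]_3) :
  (forall v, v \in std_icosahedron R -> dot v u = 0) -> u = 0.
Proof.
have phi_gt0 := golden_ratio_gt0 R.
move=> orth; have axis0 j : dot (axis R j) u = 0.
  exact: orth (axis_std R j).
have /eqP : dot u u = 0.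
  apply: (mulfI (_ : 2 * (golden_ratio R + 2) != 0)).
    by rewrite mulf_eq0 pnatr_eq0 /=; lra.
  by rewrite -axis_tight mulr0 big1 // => j _; rewrite axis0 mulr0.
rewrite psumr_eq0 => [/allP u0|k _]; last by rewrite -expr2 sqr_ge0.
apply/colP => k; rewrite mxE; apply/eqP.
by have := u0 k (mem_index_enum k); rewrite mulf_eq0 orbb.
Qed.

(** Comparing the norms of antipodal vertices [c Q v + t] and [- c Q v + t] shows
    that the centre [t] is orthogonal to every [Q v], hence zero. *)
Lemma inscribed_icosahedron (R : rcfType) (r : R) (V : seq 'cV[R]_3) :
  regular_icosahedron V -> inscribed_in_sphere r V ->
  exists (c : R) (Q : 'M[R]_3),
    [/\ 0 < c, orthogonal_mx Q, c ^+ 2 * (golden_ratio R + 2) = r ^+ 2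
      & V =i [seq c *: (Q *m v) | v <- std_icosahedron R]].
Proof.
move=> [c [Q [t [c_gt0 Q_orth VE]]]] V_r.
have norm_r v : v \in std_icosahedron R ->
    dot (c *: (Q *m v) + t) (c *: (Q *m v) + t) = r ^+ 2.
  move=> v_in; rewrite -eucl_norm_sqr V_r // VE.
  exact: (map_f (fun v => c *: (Q *m v) + t)).
have t0 : t = 0.
  have : Q^T *m t = 0.
    apply: orthogonal_to_std_icosahedron => v v_in.
    rewrite -dot_mulmxl; apply: (mulfI (_ : 4 * c != 0)).
      by rewrite mulf_neq0 ?pnatr_eq0 ?gt_eqF.
    rewrite mulr0 -(subrr (r ^+ 2)) -{1}(norm_r v v_in).
    rewrite -(norm_r _ (std_icosahedron_opp v_in)) mulmxN.
    rewrite !(dotDl, dotDr) -!scaleN1r !(dotZl, dotZr) (dotC t).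
    by ring.
  move=> Qt; have := mulmx1C Q_orth => /(congr1 (mulmx^~ t)).
  by rewrite -mulmxA Qt mulmx0 mul1mx.
exists c, Q; split=> //.
  rewrite -(norm_r _ (axis_std R ord0)) t0 addr0 dotZl dotZr.
  by rewrite dot_orthogonal // axis_norm mulrA.
by move=> v; rewrite VE t0; under eq_map do rewrite addr0.
Qed.

Lemma icosahedron_quartic (R : rcfType) (P : comNzRingType)
    (f : {rmorphism R -> P}) (c : R) (Q : 'M[R]_3) (x : 'cV[P]_3) :
  orthogonal_mx Q -> (c ^+ 2 * (golden_ratio R + 2)) ^+ 2 = 5 / 6 ->
  \sum_(v <- std_icosahedron R) dot (map_mx f (c *: (Q *m v))) x ^+ 4
    = 2 * dot x x ^+ 2.
Proof.
move=> Q_orth c4.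
have fQ : orthogonal_mx (map_mx f Q)^T.
  apply: orthogonal_mx_tr.
  by rewrite /orthogonal_mx map_trmx -map_mxM Q_orth map_mx1.
transitivity (f (c ^+ 4) * \sum_(v <- std_icosahedron R)
    dot (map_mx f v) ((map_mx f Q)^T *m x) ^+ 4).
  rewrite mulr_sumr; apply: eq_bigr => v _.
  by rewrite map_mxZ map_mxM dotZl exprMn -rmorphXn dot_mulmxl.
rewrite std_icosahedron_quartic dot_orthogonal // mulrA -rmorphM.
congr (_ * _); rewrite -(rmorph_nat f); congr (f _).
have phi2 := golden_ratio_sqr R.
(* [12 phi^2 = (12 / 5) (phi + 2)^2] *)
transitivity (12 / 5 * (c ^+ 2 * (golden_ratio R + 2)) ^+ 2); last first.
  by rewrite c4; field.
by field: phi2.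
Qed.

(** * Polynomial identities and their values *)

Definition vars (K : comNzRingType) : 'cV[{mpoly K[3]}]_3 := \col_k 'X_k.

Lemma lin_formE (K : comNzRingType) (a : 'cV[K]_3) :
  lin_form a = dot (map_mx (@mpolyC 3 K) a) (vars K).
Proof. by apply: eq_bigr => k _; rewrite !mxE mul_mpolyC. Qed.

Lemma quad_formE (K : comNzRingType) : quad_form K 3 = dot (vars K) (vars K).
Proof. by apply: eq_bigr => k _; rewrite !mxE expr2. Qed.

Lemma quartic_rep_of_mpoly (K : comNzRingType) (a : 'I_6 -> 'cV[K]_3) :
  quad_form K 3 ^+ 2 = \sum_(j < 6) lin_form (a j) ^+ 4 -> quartic_rep a.
Proof.
move=> rep_a x.
pose ev : {rmorphism {mpoly K[3]} -> K} := meval (fun k => x k ord0).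
have ev_vars : map_mx ev (vars K) = x.
  by apply/colP => k; rewrite !mxE /ev /= mevalXU.
have ev_const (y : 'cV[K]_3) : map_mx ev (map_mx (@mpolyC 3 K) y) = y.
  by apply/colP => k; rewrite !mxE /ev /= mevalC.
have := congr1 ev rep_a; rewrite quad_formE rmorphXn.
rewrite -(dot_map ev) ev_vars rmorph_sum => ->; apply: eq_bigr => j _.
by rewrite rmorphXn lin_formE -(dot_map ev) ev_vars ev_const.
Qed.

(** * The two implications *)

Lemma scaled_icosahedron_regular (R : rcfType) (c : R) :
  0 < c -> regular_icosahedron [seq c *: v | v <- std_icosahedron R].
Proof.
move=> c_gt0; exists c, 1%:M, 0; split=> //.
  by rewrite /orthogonal_mx trmx1 mul1mx.
by move=> w; under [in RHS]eq_map do rewrite mul1mx addr0.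
Qed.

Lemma scaled_icosahedron_inscribed (R : rcfType) (c : R) :
  inscribed_in_sphere (Num.sqrt (c ^+ 2 * (golden_ratio R + 2)))
    [seq c *: v | v <- std_icosahedron R].
Proof.
move=> _ /mapP[v v_in ->].
rewrite -(std_icosahedron_norm v_in) expr2 -mulrA -dotZr -dotZl.
by rewrite -eucl_norm_sqr sqrtr_sqr ger0_norm ?sqrtr_ge0.
Qed.

Lemma complexify_scaled_icosahedron (R : rcfType) (c : R) (p : 'S_6)
    (b : 'I_6 -> 'cV[R[i]%C]_3) :
  (forall j, b (p j) = complexify (c *: axis R j)) ->
  [seq complexify v | v <- [seq c *: v | v <- std_icosahedron R]] =i
  [seq s *: b j | s <- [:: 1; -1], j <- enum 'I_6].
Proof.
move=> bE.
have complexifyZ (s : R) (v : 'cV[R]_3) :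
    complexify (s *: v) = (s%:C)%C *: complexify v.
  by rewrite /complexify map_mxZ.
have signC : [seq (s%:C)%C | s : R <- [:: 1; -1]] = [:: 1; -1].
  by rewrite /= rmorphN rmorph1.
have scaled_in t j : t \in [:: 1; -1] ->
    c *: (t *: axis R j) \in [seq c *: v | v <- std_icosahedron R].
  by move=> t_in; apply/(map_f (fun v => c *: v))/scale_axis_std.
move=> w; apply/mapP/allpairsP => [[_ /mapP[v v_in ->] ->]|].
  move: v_in; rewrite std_icosahedron_axis => /allpairsP[[s j] /= [s_in _ ->]].
  exists ((s%:C)%C, p j); split; rewrite ?mem_enum //=.
    by rewrite -signC; apply: (map_f (@real_complex R)).
  by rewrite bE -complexifyZ !scalerA mulrC.
move=> [[s j] /= [s_in _ ->]]; move: s_in; rewrite -signC => /mapP[t t_in ->].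
exists (c *: (t *: axis R (p^-1%g j))); first exact: scaled_in.
by rewrite -{1}[j](permKV p) bE -complexifyZ !scalerA mulrC.
Qed.

Lemma sum_antipodes (K : nzRingType) (U : lmodType K) (P : nmodType) n
    (v : 'I_n -> U) (F : U -> P) :
  \sum_(w <- [seq s *: v j | s <- [:: 1; -1], j <- enum 'I_n]) F w =
  \sum_j F (1 *: v j) + \sum_j F (-1 *: v j).
Proof.
by rewrite big_allpairs_dep /= !big_cons big_nil addr0 !big_enum.
Qed.

(** Both lists have twelve entries and the vertices are distinct, so equality as
    sets forces equality as multisets, and sums over the two lists agree.  The
    factor 2 counts the two antipodes; the identity is stated at a vector over an
    arbitrary ring, to be used with the vector of variables. *)
Lemma icosahedron_doubled_quartic (R : rcfType) (a : 'I_6 -> 'cV[R[i]%C]_3)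
    (A : 'M[R[i]%C]_3) (eps : 'I_6 -> R[i]%C) (V : seq 'cV[R]_3)
    (P : comNzRingType) (f : {rmorphism R[i]%C -> P}) (x : 'cV[P]_3) :
  orthogonal_mx A -> (forall j, eps j ^+ 4 = 1) -> regular_icosahedron V ->
  inscribed_in_sphere (Num.sqrt (Num.sqrt (5 / 6))) V ->
  [seq complexify v | v <- V] =i
    [seq s *: (eps j *: (A *m a j)) | s <- [:: 1; -1], j <- enum 'I_6] ->
  2 * dot x x ^+ 2 = 2 * \sum_(j < 6) dot (map_mx f (a j)) x ^+ 4.
Proof.
move=> A_orth eps4 V_reg V_r VE.
have [c [Q [c_gt0 Q_orth c2 V_std]]] := inscribed_icosahedron V_reg V_r.
have c4 : (c ^+ 2 * (golden_ratio R + 2)) ^+ 2 = 5 / 6.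
  by rewrite c2 sqr_sqrtr ?sqrtr_ge0 // sqr_sqrtr //; lra.
pose W := [seq complexify (c *: (Q *m v)) | v <- std_icosahedron R].
set L := [seq _ | s <- _, j <- _] in VE.
have WL : W =i L by move=> w; rewrite -VE (eq_mem_map _ V_std) -map_comp.
have W_uniq : uniq W.
  rewrite map_inj_uniq ?std_icosahedron_uniq // => v1 v2.
  move=> /map_mx_inj/(scalerI (lt0r_neq0 c_gt0)).
  by move=> /(congr1 (mulmx Q^T)); rewrite !mulmxA Q_orth !mul1mx.
have W_perm : perm_eq W L.
  apply: uniq_perm => //; rewrite -(eq_uniq _ WL) //.
  by rewrite size_map size_allpairs size_enum_ord.
have fA_orth : orthogonal_mx (map_mx f A).
  by rewrite /orthogonal_mx map_trmx -map_mxM A_orth map_mx1.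
pose y := map_mx f A *m x.
transitivity (\sum_(w <- W) dot (map_mx f w) y ^+ 4).
  rewrite -(dot_orthogonal x x fA_orth) -/y.
  rewrite -(icosahedron_quartic (f \o @real_complex R) _ Q_orth c4).
  by rewrite big_map; apply: eq_bigr => v _; rewrite map_mx_comp.
have term s : s ^+ 4 = 1 ->
    \sum_(j < 6) dot (map_mx f (s *: (eps j *: (A *m a j)))) y ^+ 4
    = \sum_(j < 6) dot (map_mx f (a j)) x ^+ 4.
  move=> s4; apply: eq_bigr => j _.
  rewrite !map_mxZ map_mxM !dotZl (dot_orthogonal _ _ fA_orth).
  by rewrite !exprMn -!rmorphXn s4 eps4 rmorph1 !mul1r.
rewrite (perm_big L W_perm) sum_antipodes mulr_natl mulr2n.
congr (_ + _); apply: term.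
- by rewrite expr1n.
- by rewrite (exprM _ 2 2) sqrrN !expr1n.
Qed.

Lemma mpoly_of_doubled (K : numFieldType) (a : 'I_6 -> 'cV[K]_3) :
  2 * dot (vars K) (vars K) ^+ 2 =
    2 * \sum_(j < 6) dot (map_mx (@mpolyC 3 K) (a j)) (vars K) ^+ 4 ->
  quad_form K 3 ^+ 2 = \sum_(j < 6) lin_form (a j) ^+ 4.
Proof.
have two_neq0 : 2 != 0 :> {mpoly K[3]}.
  by rewrite -(rmorph_nat (@mpolyC 3 K)) mpolyC_eq0 pnatr_eq0.
move=> /(mulfI two_neq0); rewrite -quad_formE => ->.
by apply: eq_bigr => j _; rewrite lin_formE.
Qed.

Theorem theorem4p32 (R : realType) (a : 'I_6 -> 'cV[R[i]%C]_3) :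
  (quad_form (R[i]%C) 3) ^+ 2 = \sum_(j < 6) lin_form (a j) ^+ 4
  <->
  exists (A : 'M[R[i]%C]_3) (eps : 'I_6 -> R[i]%C),
    [/\ orthogonal_mx A,
        forall j, eps j ^+ 4 = 1
      & exists V : seq 'cV[R]_3,
          [/\ regular_icosahedron V,
              inscribed_in_sphere (Num.sqrt (Num.sqrt (5 / 6))) V
            & [seq complexify v | v <- V] =i
              [seq s *: (eps j *: (A *m a j))
                 | s <- [:: 1; -1], j <- enum 'I_6]]].
Proof.
split=> [/quartic_rep_of_mpoly/quartic_rep_icosahedron|].
  move=> [A [eps [c [p [A_orth eps4 [c_gt0 c2] AE]]]]].
  exists A, eps; split=> //; exists [seq c *: v | v <- std_icosahedron R].
  split; first exact: scaled_icosahedron_regular.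
    by rewrite -c2; apply: scaled_icosahedron_inscribed.
  exact: complexify_scaled_icosahedron AE.
move=> [A [eps [A_orth eps4 [V [V_reg V_r VE]]]]].
apply: mpoly_of_doubled.
exact: icosahedron_doubled_quartic A_orth eps4 V_reg V_r VE.
Qed.
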